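(* Let $J$ be a finite set and let $\{\pi^i_j:A_i\to A_{ij}=A_{ji}\}_{i,j\in J,\,i\neq j}$ be a family of algebra homomorphisms (respectively, of right $H$-comodule algebra morphisms, for a Hopf algebra $H$) which is distributive and satisfies the cocycle condition. Suppose there exist two families $\alpha^i_j,\beta^i_j:A_{ij}\to A_i$, $i,j\in J$, $i\neq j$, of linear (respectively, right $H$-colinear) splittings of the $\pi^i_j$'s (i.e. $\pi^i_j\circ\alpha^i_j=\mathrm{id}=\pi^i_j\circ\beta^i_j$) such that all $\beta^i_j$ are unital and, for all distinct $i,j,k\in J$, $$\alpha^i_j\big(\pi^i_j(\ker\pi^i_k)\big)\subseteq\ker\pi^i_k .$$ Let $i\in J$, let $|J|=n+1$, and let $\kappa:\{0,\ldots,n\}\to J$ be a bijection with $\kappa_0=i$, where $\kappa_j:=\kappa(j)$. For $a\in A_i$ define $\alpha_i(a):=(a_j)_{j\in J}$, where $a_i:=a$ and $a_{\kappa_{m+1}}:=a^m_{\kappa_{m+1}}$ for $0\leq m<n$, the elements $a^k_{\kappa_{m+1}}\in A_{\kappa_{m+1}}$ ($0\le k\le m<n$) being defined inductively by $$a^0_{\kappa_{m+1}}:=\beta^{\kappa_{m+1}}_{\kappa_0}\big(\pi^{\kappa_0}_{\kappa_{m+1}}(a_{\kappa_0})\big),$$ $$a^{k+1}_{\kappa_{m+1}}:=a^k_{\kappa_{m+1}}-\alpha^{\kappa_{m+1}}_{\kappa_{k+1}}\Big(\pi^{\kappa_{m+1}}_{\kappa_{k+1}}\big(a^k_{\kappa_{m+1}}\big)-\pi^{\kappa_{k+1}}_{\kappa_{m+1}}\big(a_{\kappa_{k+1}}\big)\Big),\qquad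 0\le k<m .$$ Then $\alpha_i(a)\in A^\pi$ for all $a\in A_i$, and $\alpha_i:A_i\to A^\pi$ is a unital and linear (respectively, unital and right $H$-colinear) splitting of the projection $\pi_i:A^\pi\to A_i$, $(a_j)_{j\in J}\mapsto a_i$, where $A^\pi$ is the multi-pullback algebra of the family.
   Context: All algebras are unital algebras over a field $\mathbb{K}$ and homomorphisms are unital. Multi-pullback: for a family $\{\pi^i_j:A_i\to A_{ij}=A_{ji}\}_{i,j\in J,\,i\ne j}$ of algebra homomorphisms, $$A^\pi:=\Big\{(a_i)_{i\in J}\in\prod_{i\in J}A_i \ \Big|\ \pi^i_j(a_i)=\pi^j_i(a_j)\ \ \forall\, i,j\in J,\ i\neq j\Big\}.$$ In the comodule case, $A_i$ and $A_{ij}$ are right $H$-comodule algebras, the $\pi^i_j$ are right $H$-colinear, and $A^\pi$ carries the componentwise coaction. Distributive: the family is distributive if all $\pi^i_j$ are surjective and, for each $i$, the kernels $\ker\pi^i_j$, $j\in J\setminus\{i\}$, generate a distributive lattice of ideals of $A_i$ (with operations $+$ and $\cap$). Cocycle condition: for distinct $i,j,k\in J$ put $A^i_{jk}:=A_i/(\ker\pi^i_j+\ker\pi^i_k)$ with canonical surjection $[\cdot]^i_{jk}:A_i\to A^i_{jk}$, and let $$\pi^{ij}_k:A^i_{jk}\to A_{ij}/\pi^i_j(\ker\pi^i_k),\qquad [a_i]^i_{jk}\mapsto\pi^i_j(a_i)+\pi^i_j(\ker\pi^i_k),$$ which are isomorphisms when the $\pi^i_j$ are surjective. The family of surjective maps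 satisfies the cocycle condition if for all distinct $i,j,k\in J$: (1) $\pi^i_j(\ker\pi^i_k)=\pi^j_i(\ker\pi^j_k)$; (2) the isomorphisms $\phi^{ij}_k:=(\pi^{ij}_k)^{-1}\circ\pi^{ji}_k:A^j_{ik}\to A^i_{jk}$ satisfy $\phi^{ik}_j=\phi^{ij}_k\circ\phi^{jk}_i$. *)

(* Defs.v *)
From HB Require Import structures.
From mathcomp Require Import all_boot all_order all_algebra.
From mathcomp Require Import boolp classical_sets functions.

Set Implicit Arguments.
Unset Strict Implicit.
Unset Printing Implicit Defensive.

Import GRing.Theory.
Local Open Scope ring_scope.
Local Open Scope classical_set_scope.
Local Open Scope quotient_scope.

(* [algType K] demands 1 != 0; here the zero algebra is allowed, since A_ij = 0
   is a legitimate (and common) case. *)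
Record algebra (K : fieldType) := Algebra {
  alg_mod : lmodType K;
  alg_mul : alg_mod -> alg_mod -> alg_mod;
  alg_one : alg_mod;
  alg_mulA : associative alg_mul;
  alg_mul1l : left_id alg_one alg_mul;
  alg_mul1r : right_id alg_one alg_mul;
  alg_mulDl : left_distributive alg_mul +%R;
  alg_mulDr : right_distributive alg_mul +%R;
  alg_scaleAl : forall (c : K) x y, c *: alg_mul x y = alg_mul (c *: x) y;
  alg_scaleAr : forall (c : K) x y, c *: alg_mul x y = alg_mul x (c *: y)
}.

Definition alg_sort (K : fieldType) (A : algebra K) : Type := alg_mod A.
Coercion alg_sort : algebra >-> Sortclass.

HB.instance Definition _ (K : fieldType) (A : algebra K) :=
  GRing.Lmodule.on (alg_sort A).
HB.instance Definition _ (K : fieldType) (A : algebra K) :=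
  GRing.Zmodule_isPzRing.Build (alg_sort A) (@alg_mulA K A) (@alg_mul1l K A)
    (@alg_mul1r K A) (@alg_mulDl K A) (@alg_mulDr K A).

(* U (x) V is the set of formal finite sums of pairs (u, v), written as lists,
   modulo the congruence generated by commutativity of the sum and the
   bilinearity relations. *)
Section Tensor.
Context {K : fieldType} (U V : lmodType K).

Inductive tensor_rel : seq (U * V) -> seq (U * V) -> Prop :=
| tensor_refl s : tensor_rel s s
| tensor_sym s t : tensor_rel s t -> tensor_rel t s
| tensor_trans s t r : tensor_rel s t -> tensor_rel t r -> tensor_rel s r
| tensor_cat s s' t t' :
    tensor_rel s s' -> tensor_rel t t' -> tensor_rel (s ++ t) (s' ++ t')
| tensor_catC s t : tensor_rel (s ++ t) (t ++ s)
| tensor_Dl u u' v : tensor_rel [:: (u + u', v)] [:: (u, v); (u', v)]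
| tensor_Dr u v v' : tensor_rel [:: (u, v + v')] [:: (u, v); (u, v')]
| tensor_Z (c : K) u v : tensor_rel [:: (c *: u, v)] [:: (u, c *: v)]
| tensor_0 v : tensor_rel [:: (0, v)] [::].

Definition tensor_eqb : rel (seq (U * V)) := fun s t => `[< tensor_rel s t >].

Lemma tensor_eqb_refl : reflexive tensor_eqb.
Proof. by move=> s; apply/asboolP; exact: tensor_refl. Qed.

Lemma tensor_eqb_sym : symmetric tensor_eqb.
Proof. by move=> s t; apply/asboolP/asboolP; exact: tensor_sym. Qed.

Lemma tensor_eqb_trans : transitive tensor_eqb.
Proof.
by move=> t s r /asboolP st /asboolP tr; apply/asboolP; exact: tensor_trans tr.
Qed.

Canonical tensor_equiv :=
  EquivRel tensor_eqb tensor_eqb_refl tensor_eqb_sym tensor_eqb_trans.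

Definition tensor := {eq_quot tensor_equiv}.
HB.instance Definition _ := Choice.on tensor.
HB.instance Definition _ := EqQuotient.on tensor.

Definition ten (u : U) (v : V) : tensor := \pi_tensor [:: (u, v)].

Lemma tensor_piP s t : tensor_rel s t <-> \pi_tensor s = \pi_tensor t.
Proof.
split=> [st|]; first by apply/eqquotP/asboolP.
by move=> /eqquotP/asboolP.
Qed.

Lemma tensor_reprK (x : tensor) : \pi_tensor (repr x) = x.
Proof. exact: reprK. Qed.

Lemma tensor_repr_pi s : tensor_rel (repr (\pi_tensor s)) s.
Proof. by apply/tensor_piP; rewrite tensor_reprK. Qed.

Definition tensor_scale_seq (c : K) (s : seq (U * V)) :=
  [seq (c *: p.1, p.2) | p <- s].

Definition tensor_zero : tensor := \pi_tensor [::].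
Definition tensor_add (x y : tensor) : tensor := \pi_tensor (repr x ++ repr y).
Definition tensor_scale (c : K) (x : tensor) : tensor :=
  \pi_tensor (tensor_scale_seq c (repr x)).
Definition tensor_opp (x : tensor) : tensor := tensor_scale (-1) x.

Lemma tensor_add_pi s t :
  tensor_add (\pi_tensor s) (\pi_tensor t) = \pi_tensor (s ++ t).
Proof. by apply/tensor_piP/tensor_cat; exact: tensor_repr_pi. Qed.

Lemma tensor_rel_scale c s t :
  tensor_rel s t -> tensor_rel (tensor_scale_seq c s) (tensor_scale_seq c t).
Proof.
elim=> {s t} [s|s t _|s t r _ + _|s s' t t' _ + _|s t|u u' v|u v v'|d u v|v] /=.
- exact: tensor_refl.
- exact: tensor_sym.
- exact: tensor_trans.
- rewrite /tensor_scale_seq !map_cat; exact: tensor_cat.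
- by rewrite /tensor_scale_seq !map_cat; exact: tensor_catC.
- by rewrite /tensor_scale_seq /= scalerDr; exact: tensor_Dl.
- exact: tensor_Dr.
- by rewrite /tensor_scale_seq /= scalerA mulrC -scalerA; exact: tensor_Z.
- by rewrite /tensor_scale_seq /= scaler0; exact: tensor_0.
Qed.

Lemma tensor_scale_pi c s :
  tensor_scale c (\pi_tensor s) = \pi_tensor (tensor_scale_seq c s).
Proof. by apply/tensor_piP/tensor_rel_scale; exact: tensor_repr_pi. Qed.

Lemma tensor_addA : associative tensor_add.
Proof.
move=> x y z; rewrite -(tensor_reprK x) -(tensor_reprK y) -(tensor_reprK z).
by rewrite !tensor_add_pi catA.
Qed.

Lemma tensor_addC : commutative tensor_add.
Proof.
move=> x y; rewrite -(tensor_reprK x) -(tensor_reprK y) !tensor_add_pi.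
by apply/tensor_piP; exact: tensor_catC.
Qed.

Lemma tensor_add0 : left_id tensor_zero tensor_add.
Proof. by move=> x; rewrite -(tensor_reprK x) tensor_add_pi. Qed.

Lemma tensor_scaleDl x :
  {morph tensor_scale^~ x : c d / c + d >-> tensor_add c d}.
Proof.
move=> c d; rewrite -(tensor_reprK x) !tensor_scale_pi tensor_add_pi.
apply/tensor_piP; elim: (repr x) => [|[u v] s IHs]; first exact: tensor_refl.
rewrite /= scalerDl.
apply: (@tensor_trans _ ([:: (c *: u, v); (d *: u, v)] ++
          (tensor_scale_seq c s ++ tensor_scale_seq d s))).
  by rewrite -cat1s; apply: tensor_cat; [exact: tensor_Dl | exact: IHs].
rewrite -[_ ++ _]/([:: _] ++ ([:: (d *: u, v)] ++ (_ ++ _))).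
rewrite -[X in tensor_rel _ X]/([:: _] ++ (_ ++ ([:: (d *: u, v)] ++ _))).
apply: tensor_cat; first exact: tensor_refl.
by rewrite !catA; apply: tensor_cat (tensor_refl _); exact: tensor_catC.
Qed.

Lemma tensor_scale0 x : tensor_scale 0 x = tensor_zero.
Proof.
rewrite -(tensor_reprK x) tensor_scale_pi; apply/tensor_piP.
elim: (repr x) => [|[u v] s IHs]; first exact: tensor_refl.
by rewrite /= scale0r -cat1s -[X in tensor_rel _ X]cat0s;
   apply: tensor_cat; [exact: tensor_0 | exact: IHs].
Qed.

Lemma tensor_scale1 : left_id 1 tensor_scale.
Proof.
move=> x; rewrite -(tensor_reprK x) tensor_scale_pi; congr \pi.
by rewrite -[RHS]map_id; apply: eq_map => -[u v] /=; rewrite scale1r.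
Qed.

Lemma tensor_addN : left_inverse tensor_zero tensor_opp tensor_add.
Proof.
move=> x; rewrite /tensor_opp -{2}[x]tensor_scale1 -tensor_scaleDl addNr.
exact: tensor_scale0.
Qed.

Lemma tensor_scaleA c d x :
  tensor_scale c (tensor_scale d x) = tensor_scale (c * d) x.
Proof.
rewrite -(tensor_reprK x) !tensor_scale_pi; congr \pi.
by rewrite /tensor_scale_seq -map_comp; apply: eq_map => p /=; rewrite scalerA.
Qed.

Lemma tensor_scaleDr : right_distributive tensor_scale tensor_add.
Proof.
move=> c x y; rewrite -(tensor_reprK x) -(tensor_reprK y).
by rewrite tensor_add_pi !tensor_scale_pi tensor_add_pi /tensor_scale_seq map_cat.
Qed.

HB.instance Definition _ := GRing.isZmodule.Build tensor
  tensor_addA tensor_addC tensor_add0 tensor_addN.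
HB.instance Definition _ := GRing.Zmodule_isLmodule.Build K tensor
  tensor_scaleA tensor_scale1 tensor_scaleDr tensor_scaleDl.

End Tensor.

Section TensorMaps.
Context {K : fieldType}.
Implicit Types U V W : lmodType K.

(* The map induced on U (x) V by u (x) v |-> f u v; meaningful (that is,
   independent of representatives) for bilinear f only, see [tliftP]. *)
Definition tlift U V W (f : U -> V -> W) (t : tensor U V) : W :=
  \sum_(p <- repr t) f p.1 p.2.

Lemma tliftP U V W (f : U -> V -> W) :
  (forall v, linear (f^~ v)) -> (forall u, linear (f u)) ->
  linear (tlift f) /\ forall u v, tlift f (ten u v) = f u v.
Proof.
move=> fl fr.
have fDl u u' v : f (u + u') v = f u v + f u' v.
  by have := fl v 1 u u'; rewrite !scale1r.
have fDr u v v' : f u (v + v') = f u v + f u v'.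
  by have := fr u 1 v v'; rewrite !scale1r.
have f0l v : f 0 v = 0 by apply: (addrI (f 0 v)); rewrite -fDl !addr0.
have f0r u : f u 0 = 0 by apply: (addrI (f u 0)); rewrite -fDr !addr0.
have fZl c u v : f (c *: u) v = c *: f u v.
  by have := fl v c u 0; rewrite f0l !addr0.
have fZr c u v : f u (c *: v) = c *: f u v.
  by have := fr u c v 0; rewrite f0r !addr0.
have wd s t : tensor_rel s t ->
    \sum_(p <- s) f p.1 p.2 = \sum_(p <- t) f p.1 p.2.
  elim=> {s t} [//|s t _ -> //|s t r _ -> _ -> //|s s' t t' _ + _|s t
               |u u' v|u v v'|c u v|v].
  - by rewrite !big_cat /= => -> ->.
  - by rewrite !big_cat /= addrC.
  - by rewrite !big_cons !big_nil !addr0 fDl.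
  - by rewrite !big_cons !big_nil !addr0 fDr.
  - by rewrite !big_cons !big_nil !addr0 fZl fZr.
  - by rewrite big_cons !big_nil f0l addr0.
have lpi s : tlift f (\pi_(tensor U V) s) = \sum_(p <- s) f p.1 p.2.
  exact/wd/tensor_repr_pi.
split=> [c x y|u v]; last by rewrite /ten lpi big_seq1.
rewrite -(tensor_reprK x) -(tensor_reprK y).
rewrite -[_ + _]/(tensor_add (tensor_scale _ _) _).
rewrite tensor_scale_pi tensor_add_pi !lpi big_cat /= big_map scaler_sumr.
by congr (_ + _); apply: eq_bigr => p _; rewrite fZl.
Qed.

Definition tmap U U' V V' (f : U -> U') (g : V -> V') :
    tensor U V -> tensor U' V' :=
  tlift (fun u v => ten (f u) (g v)).

Definition tassoc U V W : tensor (tensor U V) W -> tensor U (tensor V W) :=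
  tlift (fun t w => tlift (fun u v => ten u (ten v w)) t).

Definition tone (A B : algebra K) : tensor A B := ten (1 : A) (1 : B).

(* The product (a (x) b)(a' (x) b') = aa' (x) bb' of A (x) B. *)
Definition tmul (A B : algebra K) (s t : tensor A B) : tensor A B :=
  tlift (fun (a : A) (b : B) =>
    tlift (fun (a' : A) (b' : B) => ten (a * a') (b * b')) t) s.

End TensorMaps.

Record hopf_algebra (K : fieldType) := HopfAlgebra {
  hopf_alg :> algebra K;
  comul : {linear hopf_alg -> tensor hopf_alg hopf_alg};
  counit : {linear hopf_alg -> K^o};
  antipode : {linear hopf_alg -> hopf_alg};
  comulA : forall h, tassoc (tmap comul id (comul h)) = tmap id comul (comul h);
  counitl : forall h, tlift (fun x y => counit x *: y) (comul h) = h;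
  counitr : forall h, tlift (fun x y => counit y *: x) (comul h) = h;
  comul1 : comul 1 = tone hopf_alg hopf_alg;
  comulM : forall x y, comul (x * y) = tmul (comul x) (comul y);
  counit1 : counit 1 = 1;
  counitM : forall x y, counit (x * y) = counit x * counit y;
  antipodel : forall h,
    tlift (fun x y : hopf_alg => antipode x * y) (comul h) = counit h *: (1 : hopf_alg);
  antipoder : forall h,
    tlift (fun x y : hopf_alg => x * antipode y) (comul h) = counit h *: (1 : hopf_alg)
}.

Section Comodules.
Context {K : fieldType} (H : hopf_algebra K).

Record is_comodule_algebra (A : algebra K) (rho : A -> tensor A H) : Prop := {
  coact_linear : linear rho;
  coactA : forall a,
    tassoc (tmap rho id (rho a)) = tmap id (comul H) (rho a);
  coact_counit : forall a, tlift (fun x (h : H) => counit H h *: x) (rho a) = a;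
  coact1 : rho 1 = tone A H;
  coactM : forall a b, rho (a * b) = tmul (rho a) (rho b)
}.

Definition colinear (U V : lmodType K) (rhoU : U -> tensor U H)
    (rhoV : V -> tensor V H) (f : U -> V) : Prop :=
  forall u, rhoV (f u) = tmap f id (rhoU u).

End Comodules.

Section Product.
Context {K : fieldType} {J : Type} (A : J -> algebra K).

Definition prod_alg := forall j, A j.
HB.instance Definition _ := Choice.on prod_alg.

Implicit Types a b c : prod_alg.

Definition prod_zero : prod_alg := fun=> 0.
Definition prod_one : prod_alg := fun=> 1.
Definition prod_opp a : prod_alg := fun j => - a j.
Definition prod_add a b : prod_alg := fun j => a j + b j.
Definition prod_mul a b : prod_alg := fun j => a j * b j.
Definition prod_scale (k : K) a : prod_alg := fun j => k *: a j.

Local Ltac pointwise lem := move=> *; apply: functional_extensionality_dep => j; exact: lem.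

Lemma prod_addA : associative prod_add. Proof. pointwise addrA. Qed.
Lemma prod_addC : commutative prod_add. Proof. pointwise addrC. Qed.
Lemma prod_add0 : left_id prod_zero prod_add. Proof. pointwise add0r. Qed.
Lemma prod_addN : left_inverse prod_zero prod_opp prod_add.
Proof. pointwise addNr. Qed.
HB.instance Definition _ := GRing.isZmodule.Build prod_alg
  prod_addA prod_addC prod_add0 prod_addN.

Lemma prod_mulA : associative prod_mul. Proof. pointwise mulrA. Qed.
Lemma prod_mul1l : left_id prod_one prod_mul. Proof. pointwise mul1r. Qed.
Lemma prod_mul1r : right_id prod_one prod_mul. Proof. pointwise mulr1. Qed.
Lemma prod_mulDl : left_distributive prod_mul +%R. Proof. pointwise mulrDl. Qed.
Lemma prod_mulDr : right_distributive prod_mul +%R. Proof. pointwise mulrDr. Qed.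
HB.instance Definition _ := GRing.Zmodule_isPzRing.Build prod_alg
  prod_mulA prod_mul1l prod_mul1r prod_mulDl prod_mulDr.

Lemma prod_scaleA k l a : prod_scale k (prod_scale l a) = prod_scale (k * l) a.
Proof. pointwise scalerA. Qed.
Lemma prod_scale1 : left_id 1 prod_scale. Proof. pointwise scale1r. Qed.
Lemma prod_scaleDr : right_distributive prod_scale +%R.
Proof. pointwise scalerDr. Qed.
Lemma prod_scaleDl a : {morph prod_scale^~ a : k l / k + l}.
Proof. pointwise scalerDl. Qed.
HB.instance Definition _ := GRing.Zmodule_isLmodule.Build K prod_alg
  prod_scaleA prod_scale1 prod_scaleDr prod_scaleDl.

Lemma prod_scaleAl k a b : k *: (a * b) = (k *: a) * b.
Proof. by apply: functional_extensionality_dep => j; exact: alg_scaleAl. Qed.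
Lemma prod_scaleAr k a b : k *: (a * b) = a * (k *: b).
Proof. by apply: functional_extensionality_dep => j; exact: alg_scaleAr. Qed.
Lemma prod_evalD a b j : (a + b) j = a j + b j. Proof. by []. Qed.
Lemma prod_evalB a b j : (a - b) j = a j - b j. Proof. by []. Qed.
Lemma prod_evalM a b j : (a * b) j = a j * b j. Proof. by []. Qed.
Lemma prod_evalZ k a j : (k *: a) j = k *: a j. Proof. by []. Qed.

End Product.

Definition upair (J : finType) (i j : J) : {set J} := [set i; j]%SET.

(* The algebras A_ij = A_ji are indexed by unordered pairs: A_ij is
   [falg2 F (upair i j)].  Then pi^i_j is [fpi F (upair i j) i] and pi^j_i is
   [fpi F (upair i j) j], with the same codomain.  Only the values at the pairs
   p = {i, j} with i != j, and at i \in p, are meaningful; the others are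
   unconstrained, and can always be filled in with zero algebras and zero maps. *)
Record gluing_family (K : fieldType) (J : finType) := GluingFamily {
  falg : J -> algebra K;
  falg2 : {set J} -> algebra K;
  fpi : forall (p : {set J}) (i : J), {linear falg i -> falg2 p};
  fpi_morph : forall i j, i != j -> monoid_morphism (fpi (upair i j) i)
}.

Section MultiPullback.
Context {K : fieldType} {J : finType} (F : gluing_family K J).

Definition in_pullback : {pred prod_alg (falg F)} := fun a =>
  `[< forall i j, i != j ->
        fpi F (upair i j) i (a i) = fpi F (upair i j) j (a j) >].

Record multi_pullback :=
  MultiPullback { pb_val : prod_alg (falg F); _ : pb_val \in in_pullback }.

HB.instance Definition _ := [isSub for pb_val].
HB.instance Definition _ := [Choice of multi_pullback by <:].

Lemma fpi_morph_sym i j : i != j -> monoid_morphism (fpi F (upair i j) j).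
Proof.
move=> ij; rewrite (_ : upair i j = upair j i); last exact: finset.setUC.
by apply: fpi_morph; rewrite eq_sym.
Qed.

Lemma in_pullback_subring : subring_closed in_pullback.
Proof.
split=> [|a b /asboolP aP /asboolP bP|a b /asboolP aP /asboolP bP];
  apply/asboolP => i j ij.
- by rewrite (fpi_morph F ij).1 (fpi_morph_sym ij).1.
- by rewrite !prod_evalB !raddfB; congr (_ - _); [exact: aP | exact: bP].
- rewrite !prod_evalM (fpi_morph F ij).2 (fpi_morph_sym ij).2.
  by congr (_ * _); [exact: aP | exact: bP].
Qed.

Lemma in_pullback_submod : subsemimod_closed in_pullback.
Proof.
split; first split; first by apply/asboolP => i j _; rewrite !raddf0.
  move=> a b /asboolP aP /asboolP bP; apply/asboolP => i j ij.
  by rewrite !prod_evalD !raddfD; congr (_ + _); [exact: aP | exact: bP].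
move=> k a /asboolP aP; apply/asboolP => i j ij.
by rewrite !prod_evalZ !linearZ_LR; congr (_ *: _); exact: aP.
Qed.

HB.instance Definition _ := GRing.SubChoice_isSubPzRing.Build _ _
  multi_pullback in_pullback_subring.
HB.instance Definition _ := GRing.SubZmodule_isSubLmodule.Build _ _ _
  multi_pullback in_pullback_submod.

Lemma pb_scaleAl (k : K) (a b : multi_pullback) : k *: (a * b) = (k *: a) * b.
Proof. by apply: val_inj; exact: prod_scaleAl. Qed.
Lemma pb_scaleAr (k : K) (a b : multi_pullback) : k *: (a * b) = a * (k *: b).
Proof. by apply: val_inj; exact: prod_scaleAr. Qed.

Definition pullback_algebra : algebra K :=
  Algebra (@mulrA multi_pullback) (@mul1r multi_pullback)
    (@mulr1 multi_pullback) (@mulrDl multi_pullback) (@mulrDr multi_pullback)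
    pb_scaleAl pb_scaleAr.

Definition pb_proj (j : J) (a : multi_pullback) : falg F j := pb_val a j.

End MultiPullback.
Arguments in_pullback {K J} F _.

(* Quotients are taken as sets of cosets: A / I is the set of all a + I, so
   that quotients by equal ideals are equal and no transport is needed. *)
Section Cosets.
Context {U V : zmodType}.

Definition ideal_add (I I' : set U) : set U := [set x + y | x in I & y in I'].
Definition coset (I : set U) (x : U) : set U := [set x + y | y in I].
Definition cosets (I : set U) : set (set U) := range (coset I).

End Cosets.

(* The map [x] |-> f x + f(I), read off on any representative x of the coset. *)
Definition coset_map (U V : zmodType) (f : U -> V) (I C : set U) : set V :=
  coset (f @` I) (f (xget 0 C)).

Section Conditions.
Context {K : fieldType} {J : finType} (F : gluing_family K J).

Definition fker (i j : J) : set (falg F i) :=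
  [set a | fpi F (upair i j) i a = 0].
Arguments fker i j : clear implicits.

Inductive ker_lattice (i : J) : set (falg F i) -> Prop :=
| ker_lattice_gen j : j != i -> ker_lattice (fker i j)
| ker_lattice_add I I' :
    ker_lattice I -> ker_lattice I' -> ker_lattice (ideal_add I I')
| ker_lattice_cap I I' :
    ker_lattice I -> ker_lattice I' -> ker_lattice (I `&` I').

Definition distributive_family : Prop :=
  (forall i j, i != j -> forall y, exists x, fpi F (upair i j) i x = y) /\
  (forall (i : J) (I1 I2 I3 : set (falg F i)),
     ker_lattice I1 -> ker_lattice I2 -> ker_lattice I3 ->
     I1 `&` ideal_add I2 I3 = ideal_add (I1 `&` I2) (I1 `&` I3)).

(* A^i_jk := A_i / (ker pi^i_j + ker pi^i_k). *)
Definition quot_alg (i j k : J) : set (set (falg F i)) :=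
  cosets (ideal_add (fker i j) (fker i k)).
Arguments quot_alg i j k : clear implicits.

(* The map phi^ij_k = (pi^ij_k)^-1 \o pi^ji_k : A^j_ik -> A^i_jk, where pi^ij_k and
   pi^ji_k take values in the cosets of pi^i_j(ker pi^i_k) = pi^j_i(ker pi^j_k)
   in A_ij. *)
Definition transition (i j k : J) (C : set (falg F j)) : set (falg F i) :=
  'pinv_(fun=> set0) (quot_alg i j k)
    (coset_map (fpi F (upair i j) i) (fker i k))
    (coset_map (fpi F (upair i j) j) (fker j k) C).
Arguments transition i j k C : clear implicits.

Definition cocycle_condition : Prop :=
  forall i j k, uniq [:: i; j; k] ->
    fpi F (upair i j) i @` fker i k = fpi F (upair i j) j @` fker j k /\
    forall C, quot_alg k i j C ->
      transition i k j C = transition i j k (transition j k i C).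

End Conditions.
Arguments fker {K J} F i j _.
Arguments quot_alg {K J} F i j k _.
Arguments transition {K J} F i j k C _.

Section Splitting.
Context {K : fieldType} {J : finType} (F : gluing_family K J).

Definition splittings := forall (p : {set J}) (i : J), {linear falg2 F p -> falg F i}.

Definition is_splitting (s : splittings) : Prop :=
  forall i j, i != j -> cancel (s (upair i j) i) (fpi F (upair i j) i).

Context (al be : splittings) (kappa : nat -> J).

(* a^k_j, computed from the components x_(kappa 0), ..., x_(kappa k). *)
Fixpoint corrected (x : prod_alg (falg F)) (j : J) (k : nat) : falg F j :=
  match k with
  | 0%N => be (upair j (kappa 0)) j (fpi F (upair j (kappa 0)) (kappa 0) (x (kappa 0)))
  | k'.+1 =>
      let p := upair j (kappa k'.+1) in
      let b := corrected x j k' in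
      b - al p j (fpi F p j b - fpi F p (kappa k'.+1) (x (kappa k'.+1)))
  end.

(* The tuple whose components a_(kappa 0), ..., a_(kappa m) have been computed,
   the remaining ones being 0. *)
Fixpoint partial_tuple (i : J) (a : falg F i) (m : nat) : prod_alg (falg F) :=
  match m with
  | 0%N => dfwith (fun=> 0) a
  | m'.+1 =>
      let x := partial_tuple a m' in
      dfwith x (corrected x (kappa m'.+1) m')
  end.

End Splitting.

Section SplittingTuple.
Context {K : fieldType} {J : finType} (F : gluing_family K J).
Context (al be : splittings F) (n : nat) (kappa : 'I_n.+1 -> J).

(* The tuple alpha_i(a); the argument i is meant to be kappa 0. *)
Definition alpha_tuple (i : J) (a : falg F i) : prod_alg (falg F) :=
  partial_tuple al be (fun m => kappa (inord m)) a n.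

Let kap (m : nat) : J := kappa (inord m).

Lemma kap_inj (m l : nat) : injective kappa -> (m <= n)%N -> (l <= n)%N ->
  kap m = kap l -> m = l.
Proof. by move=> kinj mn ln /kinj/(congr1 val); rewrite /= !inordK. Qed.

Lemma partial_tuple_stable (i : J) (a : falg F i) (l m k : nat) :
  injective kappa -> (l <= m)%N -> (m <= k)%N -> (k <= n)%N ->
  partial_tuple al be kap a k (kap l) = partial_tuple al be kap a m (kap l).
Proof.
move=> kinj lm + kn; elim: k kn => [|k IHk] kn mk.
  by move: mk; rewrite leqn0 => /eqP->.
move: mk; rewrite leq_eqVlt => /predU1P[->//|]; rewrite ltnS => mk.
rewrite /= dfwith_out; first by apply: IHk => //; exact: ltnW.
have lk := leq_trans lm mk; apply/eqP => e.
by move: (lk); rewrite -(kap_inj kinj kn (leq_trans lk (ltnW kn)) e) ltnn.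
Qed.

Lemma corrected_ext (x y : prod_alg (falg F)) (j : J) (k : nat) :
  (forall l, (l <= k)%N -> x (kap l) = y (kap l)) ->
  corrected al be kap x j k = corrected al be kap y j k.
Proof.
elim: k => [|k IHk] xy /=; first by rewrite xy.
by rewrite IHk ?xy // => l lk; apply: xy; exact: leqW.
Qed.

(* The recursion characterizing alpha_tuple: a_i = a, and
   a_(kappa (m+1)) = a^m_(kappa (m+1)) computed from the final tuple. *)
Lemma alpha_tuple0 (i : J) (a : falg F i) :
  injective kappa -> kappa ord0 = i -> alpha_tuple a i = a.
Proof.
move=> kinj k0; rewrite /alpha_tuple -/kap.
have {}k0 : kap 0 = i by rewrite -k0; congr kappa; apply: val_inj; rewrite /= inordK.
suff H k : (k <= n)%N -> partial_tuple al be kap a k i = a by exact: H.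
elim: k => [|k IHk] kn /=; first by rewrite dfwith_in.
rewrite dfwith_out ?IHk ?(ltnW kn) //.
by apply/eqP; rewrite -k0 => /(kap_inj kinj kn (leq0n n)).
Qed.

Lemma alpha_tupleS (i : J) (a : falg F i) (m : nat) :
  injective kappa -> (m < n)%N ->
  alpha_tuple a (kap m.+1) =
  corrected al be kap (alpha_tuple a) (kap m.+1) m.
Proof.
move=> kinj mn; rewrite {1}/alpha_tuple -/kap.
rewrite (@partial_tuple_stable _ a m.+1 m.+1 n) //= dfwith_in.
by apply: corrected_ext => l lm; rewrite /alpha_tuple -/kap (@partial_tuple_stable _ a l m n) // ltnW.
Qed.

End SplittingTuple.

(* rhoP is the componentwise coaction (a_j)_j |-> (rho_j (a_j))_j on the
   multi-pullback: its image under every projection is the coaction of A_j. *)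
Definition is_componentwise (K : fieldType) (J : finType) (F : gluing_family K J)
    (H : hopf_algebra K) (rho : forall j, falg F j -> tensor (falg F j) H)
    (rhoP : pullback_algebra F -> tensor (pullback_algebra F) H) : Prop :=
  forall j, colinear rhoP (rho j) (pb_proj j).

(* Main.v *)
Require Import Defs.
From HB Require Import structures.
From mathcomp Require Import all_boot all_order all_algebra.
From mathcomp Require Import boolp classical_sets functions.
Import GRing.Theory.
Local Open Scope ring_scope.
Local Open Scope classical_set_scope.

Set Implicit Arguments.
Unset Strict Implicit.
Unset Printing Implicit Defensive.

(** Write pi^j_l for the gluing maps and call a tuple y compatible at (j, l) when
  pi^j_l (y_j) = pi^l_j (y_l).  Everything rests on one elementary correction
  of an arbitrary tuple y of the product of the A_j:
    y_j  becomes  y_j - alpha^j_l (pi^j_l (y_j) - pi^l_j (y_l)),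
  called [step j l].  Since alpha^j_l splits pi^j_l, the new tuple is compatible
  at (j, l).  It also stays compatible at (j, k) as soon as y was compatible at
  (j, k) and at (k, l): by the cocycle condition the error
  pi^j_l (y_j) - pi^l_j (y_l) then lies in pi^j_l (ker pi^j_k)
  ([agree_middle]), and alpha^j_l sends that ideal into ker pi^j_k
  ([step_keep]).  So correcting kappa_1, kappa_2, ... in turn, each one against
  all earlier indices, produces a tuple of the multi-pullback; this is [sweep].
  Compatible tuples are not changed, hence [sweep] is a linear retraction of the
  whole product onto the multi-pullback.

  The map alpha_i of the theorem is [sweep] applied to the tuple with a at i and
  beta^j_i (pi^i_j (a)) at j ([alpha_tuple_sweep]): the splitting beta makes this
  tuple compatible at every (j, i), so the first correction of each index is
  void and the remaining ones are those of the recursive definition.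
  Membership, linearity, unitality and the splitting property follow.

  In the comodule case the retraction also replaces the exactness properties of
  the functor - (x) H.  Because the inclusion of the multi-pullback P into the
  product has a linear retraction, the projections P -> A_j are jointly monic
  even after tensoring ([pb_proj_monic]); this gives the uniqueness of the
  coaction and reduces all comodule algebra axioms of P to those of the A_j
  ([comodule_algebra_jointly_monic]).  The coaction itself is the one of the
  product followed by [sweep] (x) id, which restricts correctly because [sweep]
  is colinear, being composed of colinear corrections. *)

(** * Linear maps *)

Section LinearMaps.
Context {K : fieldType}.
Implicit Types U V W : lmodType K.

(** Linearity is kept as a property of bare functions below, because [tmap] and
    [tlift] act on bare functions; this lemma gives access to the theory of
    bundled linear maps. *)
Lemma linear_pack U V (f : U -> V) :
  linear f -> exists g : {linear U -> V}, f = g.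
Proof.
move=> lf; pose m := GRing.isLinear.Build K U V *:%R f lf.
by exists (HB.pack f m : {linear U -> V}).
Qed.

Lemma linear_eqB U V (f : U -> V) x y : linear f -> f (x - y) = f x - f y.
Proof. by case/linear_pack=> g ->; rewrite raddfB. Qed.

Lemma linear_eq_sum U V (f : U -> V) (I : finType) (P : pred I) (x : I -> U) :
  linear f -> f (\sum_(i | P i) x i) = \sum_(i | P i) f (x i).
Proof. by case/linear_pack=> g ->; rewrite raddf_sum. Qed.

Lemma linear_idfun U : linear (fun x : U => x).
Proof. by []. Qed.

Lemma linear_fun_comp U V W (g : V -> W) (f : U -> V) :
  linear g -> linear f -> linear (fun x => g (f x)).
Proof. by move=> lg lf c x y; rewrite lf lg. Qed.

Lemma linear_fun_sub U V (f g : U -> V) :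
  linear f -> linear g -> linear (fun x => f x - g x).
Proof. by move=> lf lg c x y; rewrite lf lg scalerBr opprD addrACA. Qed.

Lemma linear_fun_add U V (f g : U -> V) :
  linear f -> linear g -> linear (fun x => f x + g x).
Proof. by move=> lf lg c x y; rewrite lf lg scalerDr addrACA. Qed.

Lemma linear_fun_scale U V (f : U -> V) (k : K) :
  linear f -> linear (fun x => k *: f x).
Proof. by move=> lf c x y; rewrite lf scalerDr !scalerA mulrC. Qed.

Lemma linear_fun_sum U V (I : finType) (P : pred I) (f : I -> U -> V) :
  (forall i, linear (f i)) -> linear (fun x => \sum_(i | P i) f i x).
Proof.
move=> lf c x y; rewrite scaler_sumr -big_split /=.
by apply: eq_bigr => i _; exact: lf.
Qed.

End LinearMaps.

(** * Tensor products *)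

Section TensorLinear.
Context {K : fieldType}.
Implicit Types U V W X : lmodType K.

Definition bilin U V W (f : U -> V -> W) :=
  (forall v, linear (f^~ v)) /\ (forall u, linear (f u)).

Lemma bilin_ten U V : bilin (@ten K U V).
Proof.
split=> [v c u u'|u c v v'].
  rewrite -[RHS]/(tensor_add (tensor_scale _ _) _).
  rewrite tensor_scale_pi tensor_add_pi.
  by apply/tensor_piP; exact: tensor_Dl.
rewrite -[RHS]/(tensor_add (tensor_scale _ _) _) tensor_scale_pi tensor_add_pi.
apply/tensor_piP; apply: tensor_trans (tensor_Dr _ _ _) _.
by apply: (@tensor_cat _ _ _ [:: _] [:: _] [:: _] [:: _]);
  [exact/tensor_sym/tensor_Z | exact: tensor_refl].
Qed.

Lemma tlift_linear U V W (f : U -> V -> W) : bilin f -> linear (tlift f).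
Proof. by case=> fl fr; have [] := tliftP fl fr. Qed.

Lemma tlift_ten U V W (f : U -> V -> W) u v :
  bilin f -> tlift f (ten u v) = f u v.
Proof. by case=> fl fr; have [] := tliftP fl fr. Qed.

Lemma tensor_decomp U V (x : tensor U V) :
  x = \sum_(p <- repr x) ten p.1 p.2.
Proof.
rewrite -{1}(tensor_reprK x); elim: (repr x) => [|[u v] s IHs].
  by rewrite big_nil.
by rewrite big_cons -IHs -[RHS]/(tensor_add _ _) tensor_add_pi.
Qed.

(** Pure tensors span: the principle behind every identity between maps out of a
    tensor product. *)
Lemma tensor_ext U V W (f g : tensor U V -> W) :
  linear f -> linear g -> (forall u v, f (ten u v) = g (ten u v)) -> f =1 g.
Proof.
move=> /linear_pack[f' ->] /linear_pack[g' ->] fg x.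
by rewrite (tensor_decomp x) !raddf_sum; apply: eq_bigr => p _; exact: fg.
Qed.

(** Allows the induced map to be used inside iterated tensor products, where one
    argument serves as a parameter while another one is decomposed. *)
Lemma tlift_linear_param X U V W (f : X -> U -> V -> W) (t : tensor U V) :
  (forall x, bilin (f x)) -> (forall u v, linear (fun x => f x u v)) ->
  linear (fun x => tlift (f x) t).
Proof.
move=> bf lf c x y.
apply: (tensor_ext (f := tlift (f (c *: x + y)))
                   (g := fun t => c *: tlift (f x) t + tlift (f y) t)).
- exact: tlift_linear.
- by apply: linear_fun_add; [apply: linear_fun_scale|]; exact: tlift_linear.
- by move=> u v; rewrite !tlift_ten //; exact: lf.
Qed.

Lemma bilin_comp U U' V V' W (f : U -> U') (g : V -> V') (h : U' -> V' -> W) :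
  linear f -> linear g -> bilin h -> bilin (fun u v => h (f u) (g v)).
Proof.
move=> lf lg [hl hr]; split=> [v|u]; [exact: (linear_fun_comp (hl (g v)) lf)|].
exact: (linear_fun_comp (hr (f u)) lg).
Qed.

Lemma tmap_linear U U' V V' (f : U -> U') (g : V -> V') :
  linear f -> linear g -> linear (tmap f g).
Proof.
by move=> lf lg; apply/tlift_linear/bilin_comp => //; exact: bilin_ten.
Qed.

Lemma tmap_ten U U' V V' (f : U -> U') (g : V -> V') u v :
  linear f -> linear g -> tmap f g (ten u v) = ten (f u) (g v).
Proof.
by move=> lf lg; apply: (tlift_ten u v (bilin_comp lf lg (bilin_ten _ _))).
Qed.

Lemma tmap_comp U U' U'' V V' V'' (f' : U' -> U'') (f : U -> U')
    (g' : V' -> V'') (g : V -> V') :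
  linear f' -> linear f -> linear g' -> linear g ->
  forall t, tmap f' g' (tmap f g t) = tmap (f' \o f) (g' \o g) t.
Proof.
move=> lf' lf lg' lg; have lff := linear_fun_comp lf' lf.
have lgg := linear_fun_comp lg' lg; apply: tensor_ext.
- by apply: linear_fun_comp; exact: tmap_linear.
- exact: tmap_linear.
- by move=> u v; rewrite !tmap_ten.
Qed.

Lemma tmap_id U V (t : tensor U V) : tmap id id t = t.
Proof.
move: t; apply: tensor_ext => [||u v]; [exact: tmap_linear | by [] |].
by rewrite tmap_ten.
Qed.

Lemma tmap_sub U U' V (f g : U -> U') (t : tensor U V) :
  linear f -> linear g ->
  tmap (fun u => f u - g u) id t = tmap f id t - tmap g id t.
Proof.
move=> lf lg; have lfg := linear_fun_sub lf lg.
move: t; apply: tensor_ext.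
- exact: tmap_linear.
- by apply: linear_fun_sub; exact: tmap_linear.
- move=> u v; rewrite !tmap_ten //.
  exact: (linear_eqB (f := fun u' => ten u' v) _ _ ((bilin_ten _ _).1 v)).
Qed.

Lemma tmap_sum U U' V (I : finType) (P : pred I) (f : I -> U -> U')
    (t : tensor U V) :
  (forall i, linear (f i)) ->
  tmap (fun u => \sum_(i | P i) f i u) id t = \sum_(i | P i) tmap (f i) id t.
Proof.
move=> lf; have lF := linear_fun_sum P lf.
move: t; apply: tensor_ext.
- exact: tmap_linear.
- by apply: linear_fun_sum => i; exact: tmap_linear.
- move=> u v; rewrite tmap_ten //.
  rewrite (linear_eq_sum (f := fun u' => ten u' v) _ _ ((bilin_ten _ _).1 v)).
  by apply: eq_bigr => i _; rewrite tmap_ten.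
Qed.

Lemma bilin_tassoc_inner U V W (t : tensor U V) :
  linear (fun w : W => tlift (fun u v => ten u (ten v w)) t) /\
  forall w : W, bilin (fun (u : U) (v : V) => ten u (ten v w)).
Proof.
have b w : bilin (fun (u : U) (v : V) => ten u (ten v w)).
  split=> [v|u]; first exact: (bilin_ten _ _).1.
  exact: (linear_fun_comp ((bilin_ten _ _).2 u) ((bilin_ten _ _).1 w)).
split=> //; apply: tlift_linear_param => // u v.
exact: (linear_fun_comp ((bilin_ten _ _).2 u) ((bilin_ten _ _).2 v)).
Qed.

Lemma bilin_tassoc U V W :
  bilin (fun (t : tensor U V) (w : W) => tlift (fun u v => ten u (ten v w)) t).
Proof.
split=> [w|t]; last exact: (bilin_tassoc_inner _ t).1.
exact/tlift_linear/((bilin_tassoc_inner W (0 : tensor U V)).2 w).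
Qed.

Lemma tassoc_linear U V W : linear (@tassoc K U V W).
Proof. exact/tlift_linear/bilin_tassoc. Qed.

Lemma tassoc_ten U V W (u : U) (v : V) (w : W) :
  tassoc (ten (ten u v) w) = ten u (ten v w).
Proof.
rewrite /tassoc tlift_ten; last exact: bilin_tassoc.
by rewrite tlift_ten //; exact: ((bilin_tassoc_inner W (0 : tensor U V)).2 w).
Qed.

Lemma tassoc_natural U U' V W (f : U -> U') (t : tensor (tensor U V) W) :
  linear f -> tassoc (tmap (tmap f id) id t) = tmap f id (tassoc t).
Proof.
move=> lf; have lf1 := tmap_linear lf (@linear_idfun K V).
move: t; apply: tensor_ext.
- by apply: linear_fun_comp; [exact: tassoc_linear|exact: tmap_linear].
- by apply: linear_fun_comp; [exact: tmap_linear|exact: tassoc_linear].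
move=> t w; move: t.
have lw X : linear (fun x : X => ten x w) by exact: (bilin_ten _ _).1.
apply: (tensor_ext
  (f := fun t => tassoc (tmap (tmap f id) id (ten t w)))
  (g := fun t => tmap f id (tassoc (ten t w)))).
- apply: (linear_fun_comp (f := fun t => tmap _ id (ten t w))
    (@tassoc_linear _ _ _)).
  exact: (linear_fun_comp (tmap_linear lf1 (@linear_idfun K W)) (lw _)).
- apply: (linear_fun_comp (f := fun t => tassoc (ten t w))
    (tmap_linear lf (@linear_idfun K _))).
  exact: (linear_fun_comp (@tassoc_linear _ _ _) (lw _)).
by move=> u v; rewrite !(tassoc_ten, tmap_ten).
Qed.

Lemma tlift_natural U U' V W X (f : U -> V -> W) (f' : U' -> V -> X)
    (p : U -> U') (q : W -> X) (t : tensor U V) :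
  bilin f -> bilin f' -> linear p -> linear q ->
  (forall u v, q (f u v) = f' (p u) v) ->
  q (tlift f t) = tlift f' (tmap p id t).
Proof.
move=> bf bf' lp lq e; move: t; apply: tensor_ext.
- by apply: linear_fun_comp => //; exact: tlift_linear.
- by apply: linear_fun_comp; [exact: tlift_linear|exact: tmap_linear].
- by move=> u v; rewrite tmap_ten // !tlift_ten.
Qed.

End TensorLinear.

Section TensorProduct.
Context {K : fieldType}.
Implicit Types A B : algebra K.

Lemma linear_alg_mulr A (x : A) : linear (fun y : A => x * y).
Proof.
move=> c y z; rewrite mulrDr; congr (_ + _); exact/esym/alg_scaleAr.
Qed.

Lemma linear_alg_mull A (x : A) : linear (fun y : A => y * x).
Proof.
move=> c y z; rewrite mulrDl; congr (_ + _); exact/esym/alg_scaleAl.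
Qed.

Lemma bilin_tmul_ten A B (a : A) (b : B) :
  bilin (fun (a' : A) (b' : B) => ten (a * a') (b * b')).
Proof.
apply: (bilin_comp (h := @ten K A B)); last exact: bilin_ten.
  exact: linear_alg_mulr.
exact: linear_alg_mulr.
Qed.

Lemma bilin_tmul_inner A B (t : tensor A B) :
  bilin (fun (a : A) (b : B) =>
    tlift (fun (a' : A) (b' : B) => ten (a * a') (b * b')) t).
Proof.
split=> [b|a]; apply: tlift_linear_param => [?|u v]; try exact: bilin_tmul_ten.
- exact: (linear_fun_comp ((bilin_ten _ _).1 _) (linear_alg_mull _)).
- exact: (linear_fun_comp ((bilin_ten _ _).2 _) (linear_alg_mull _)).
Qed.

Lemma bilin_tmul A B : bilin (@tmul K A B).
Proof.
split=> [t|s]; first exact/tlift_linear/bilin_tmul_inner.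
apply: tlift_linear_param => [t|a b]; first exact: bilin_tmul_inner.
exact/tlift_linear/bilin_tmul_ten.
Qed.

Lemma tmul_ten A B (a a' : A) (b b' : B) :
  tmul (ten a b) (ten a' b') = ten (a * a') (b * b').
Proof.
by rewrite /tmul tlift_ten ?tlift_ten //;
  [exact: bilin_tmul_ten | exact: bilin_tmul_inner].
Qed.

Lemma tmap_tmul A A' B (f : A -> A') (s t : tensor A B) :
  linear f -> (forall x y, f (x * y) = f x * f y) ->
  tmap f id (tmul s t) = tmul (tmap f id s) (tmap f id t).
Proof.
move=> lf fM; have lfi := tmap_linear lf (@linear_idfun K B).
move: t; apply: tensor_ext.
- exact: (linear_fun_comp lfi ((bilin_tmul A B).2 s)).
- exact: (linear_fun_comp ((bilin_tmul A' B).2 _) lfi).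
move=> a' b'; move: s; apply: tensor_ext.
- exact: (linear_fun_comp lfi ((bilin_tmul A B).1 _)).
- exact: (linear_fun_comp ((bilin_tmul A' B).1 _) lfi).
by move=> a b; rewrite !(tmul_ten, tmap_ten) // fM.
Qed.

End TensorProduct.

(** * Colinear maps *)

Definition comodule_hom {K : fieldType} (H : hopf_algebra K) (U V : lmodType K)
    (rhoU : U -> tensor U H) (rhoV : V -> tensor V H) (f : U -> V) :=
  linear f /\ colinear rhoU rhoV f.

Section ComoduleHom.
Context {K : fieldType} (H : hopf_algebra K).
Context (U V W : lmodType K).
Context (rhoU : U -> tensor U H) (rhoV : V -> tensor V H).
Context (rhoW : W -> tensor W H).

Lemma comodule_hom_id : comodule_hom rhoU rhoU id.
Proof. by split=> // u; rewrite tmap_id. Qed.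

Lemma comodule_hom_comp (g : V -> W) (f : U -> V) :
  comodule_hom rhoV rhoW g -> comodule_hom rhoU rhoV f ->
  comodule_hom rhoU rhoW (fun u => g (f u)).
Proof.
move=> [lg cg] [lf cf]; split=> [|u]; first exact: linear_fun_comp.
by rewrite cg cf tmap_comp.
Qed.

Lemma comodule_hom_sub (f g : U -> V) : linear rhoV ->
  comodule_hom rhoU rhoV f -> comodule_hom rhoU rhoV g ->
  comodule_hom rhoU rhoV (fun u => f u - g u).
Proof.
move=> lr [lf cf] [lg cg]; split=> [|u]; first exact: linear_fun_sub.
by rewrite tmap_sub // linear_eqB // cf cg.
Qed.

Lemma comodule_hom_ext (f g : U -> V) :
  f =1 g -> comodule_hom rhoU rhoV f -> comodule_hom rhoU rhoV g.
Proof.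
by move=> fg; have -> : f = g by exact: functional_extensionality_dep.
Qed.

End ComoduleHom.

Section ProductCoaction.
Context {K : fieldType} {J : finType} (A : J -> algebra K).

Definition in_prod (j : J) (a : A j) : prod_alg A :=
  dfwith (T := fun k => A k) (fun k => 0 : A k) a.

Lemma in_prod_in j (a : A j) : in_prod a j = a.
Proof. exact: dfwith_in. Qed.

Lemma in_prod_out j k (a : A j) : j != k -> in_prod a k = 0.
Proof. exact: dfwith_out. Qed.

Lemma in_prod_linear j : linear (@in_prod j).
Proof.
move=> c a b; apply: functional_extensionality_dep => k.
rewrite prod_evalD prod_evalZ; have [<-|jk] := eqVneq j k.
  by rewrite !in_prod_in.
by rewrite !in_prod_out // scaler0 addr0.
Qed.

Lemma proj_linear j : linear (fun x : prod_alg A => x j).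
Proof. by []. Qed.

Lemma prod_eval_sum (x : J -> prod_alg A) k :
  (\sum_j x j) k = \sum_j x j k.
Proof. exact: (linear_eq_sum _ _ (@proj_linear k)). Qed.

Lemma prod_decomp (x : prod_alg A) : x = \sum_j in_prod (x j).
Proof.
apply: functional_extensionality_dep => k; rewrite prod_eval_sum (bigD1 k) //=.
by rewrite in_prod_in big1 ?addr0 // => j jk; rewrite in_prod_out.
Qed.

Lemma linear_prod (U : lmodType K) (f : U -> prod_alg A) :
  (forall j, linear (fun u => f u j)) -> linear f.
Proof.
move=> lf c x y; apply: functional_extensionality_dep => j.
by rewrite prod_evalD prod_evalZ lf.
Qed.

Context (H : hopf_algebra K) (rho : forall j, A j -> tensor (A j) H).

Definition prod_coaction (x : prod_alg A) : tensor (prod_alg A) H :=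
  \sum_j tmap (@in_prod j) id (rho (x j)).

Lemma comodule_hom_proj j :
  comodule_hom prod_coaction (@rho j) (fun x => x j).
Proof.
split=> // x; have l k := tmap_linear (@in_prod_linear k) (@linear_idfun K H).
rewrite /prod_coaction linear_eq_sum; last exact: tmap_linear.
have tcomp k : tmap (fun x : prod_alg A => x j) id
    (tmap (@in_prod k) id (rho (x k))) =
    tmap (fun a : A k => in_prod a j) id (rho (x k)).
  by rewrite tmap_comp //; exact: in_prod_linear.
rewrite (bigD1 j) //= big1 ?addr0 => [|k kj]; rewrite tcomp.
  under [X in tmap X]functional_extensionality_dep do rewrite in_prod_in.
  by rewrite tmap_id.
have -> : (fun a : A k => in_prod a j) = fun a => in_prod a j - in_prod a j.
  by apply: functional_extensionality_dep => a; rewrite in_prod_out // subrr.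
have lk := linear_fun_comp (@proj_linear j) (@in_prod_linear k).
by rewrite tmap_sub // subrr.
Qed.

(** Universal property of the product, in the category of comodules: colinearity
    of a map into the product can be tested on components. *)
Lemma comodule_hom_prod (U : lmodType K) (rhoU : U -> tensor U H)
    (f : U -> prod_alg A) :
  (forall j, comodule_hom rhoU (@rho j) (fun u => f u j)) ->
  comodule_hom rhoU prod_coaction f.
Proof.
move=> cf; have lf j := (cf j).1; split=> [|u]; first exact: linear_prod.
have lin j := linear_fun_comp (@in_prod_linear j) (lf j).
rewrite (_ : f = fun u => \sum_j in_prod (f u j)); last first.
  by apply: functional_extensionality_dep => v; exact: prod_decomp.
rewrite tmap_sum // -prod_decomp; apply: eq_bigr => j _.
by rewrite (cf j).2 (tmap_comp (@in_prod_linear j) (lf j)).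
Qed.

End ProductCoaction.
Arguments in_prod {K J A j} a.

(** * Comodule algebras detected by jointly monic maps *)

(** The two sides of coassociativity agree after p (x) id, by naturality of both
    the associator and the coactions. *)
Lemma coassociative_image {K : fieldType} (D U V : lmodType K)
    (delta : D -> tensor D D) (rhoU : U -> tensor U D) (rhoV : V -> tensor V D)
    (p : U -> V) :
  linear delta -> linear p -> linear rhoU -> linear rhoV ->
  (forall u, rhoV (p u) = tmap p id (rhoU u)) ->
  (forall v, tassoc (tmap rhoV id (rhoV v)) = tmap id delta (rhoV v)) ->
  forall u, tmap p id (tassoc (tmap rhoU id (rhoU u))) =
            tmap p id (tmap id delta (rhoU u)).
Proof.
move=> ld lp lU lV cp cV u; have lid W := @linear_idfun K W.
have lpi := tmap_linear lp (lid D).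
rewrite -tassoc_natural // (tmap_comp lp (lid _) (lid _) ld).
rewrite -(tmap_comp (lid _) lp ld (lid _)) -cp -cV cp.
rewrite (tmap_comp lpi lU (lid _) (lid _)) (tmap_comp lV lp (lid _) (lid _)).
congr (tassoc (tmap _ _ _)).
by apply: functional_extensionality_dep => v /=; rewrite cp.
Qed.

Section JointlyMonic.
Context {K : fieldType} (H : hopf_algebra K) (J : Type) (A : algebra K).
Context (B : J -> algebra K) (p : forall j, A -> B j).

Definition tensor_jointly_monic := forall (W : lmodType K) (s t : tensor A W),
  (forall j, tmap (p j) id s = tmap (p j) id t) -> s = t.

(** Each axiom is an identity in A, in A (x) H or in A (x) (H (x) H); it can be
    tested after applying all p_j, where it becomes the same axiom of B_j. *)
Lemma comodule_algebra_jointly_monic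
    (rho : A -> tensor A H) (rhoB : forall j, B j -> tensor (B j) H) :
  (forall j, linear (p j)) -> (forall j, monoid_morphism (p j)) ->
  (forall a b, (forall j, p j a = p j b) -> a = b) -> tensor_jointly_monic ->
  (forall j, is_comodule_algebra (@rhoB j)) ->
  (forall j, colinear rho (@rhoB j) (p j)) ->
  is_comodule_algebra rho.
Proof.
move=> lp pM p_inj p_mono cB crho.
have lid V := @linear_idfun K V; have lB j := coact_linear (cB j).
have lrho : linear rho.
  move=> c a b; apply: p_mono => j; rewrite -crho (lp j) lB.
  by rewrite (tmap_linear (lp j) (lid _)) -!crho.
split=> //.
- move=> a; apply: p_mono => j.
  apply: (coassociative_image _ (lp j) lrho (lB j) (crho j)) (coactA (cB j)) a.
  by move=> *; exact: linearP.
- move=> a; apply: p_inj => j.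
  have bil (C : algebra K) : bilin (fun (x : C) (h : H) => counit H h *: x).
    split=> [h|x] c y z; first by rewrite scalerDr !scalerA mulrC.
    by rewrite linearP scalerDl -scalerA.
  rewrite (tlift_natural (rho a) (bil A) (bil (B j)) (lp j) (lp j)).
    by rewrite -crho; exact: (coact_counit (cB j) (p j a)).
  by move=> x h; have [q ->] := linear_pack (lp j); rewrite linearZ.
- apply: p_mono => j; rewrite -crho (pM j).1.
  apply: etrans (coact1 (cB j)) _.
  by rewrite /tone (tmap_ten _ _ (lp j) (lid _)) (pM j).1.
- move=> a b; apply: p_mono => j; rewrite -crho (pM j).2.
  apply: etrans (coactM (cB j) _ _) _.
  by rewrite !crho; exact/esym/(tmap_tmul _ _ (lp j) (pM j).2).
Qed.

End JointlyMonic.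

Section PullbackComodule.
Context {K : fieldType} {J : finType} (F : gluing_family K J).
Local Notation P := (pullback_algebra F).
Local Notation A := (falg F).

Lemma pb_proj_linear j : linear (pb_proj j : P -> A j).
Proof. by []. Qed.

Lemma pb_val_inj (a b : P) : (forall j, pb_proj j a = pb_proj j b) -> a = b.
Proof. by move=> ab; apply: val_inj; exact: functional_extensionality_dep. Qed.

Context (r : prod_alg A -> P) (rlin : linear r).
Context (rK : forall a, r (pb_val a) = a).

(** An element x of P (x) W is recovered from its images x_j in A_j (x) W as the
    sum over j of (r in_j (x) id) (x_j), because r retracts the product onto P and
    the identity of the product is the sum of the in_j pr_j. *)
Lemma pb_proj_monic : tensor_jointly_monic (fun j => pb_proj j : P -> A j).
Proof.
move=> W s t st.
have lri j := linear_fun_comp rlin (@in_prod_linear _ _ A j).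
have E (x : tensor P W) : x =
    \sum_j tmap (fun a : A j => r (in_prod a)) id
             (tmap (pb_proj j : P -> A j) id x).
  under eq_bigr => j _ do rewrite tmap_comp //.
  rewrite -tmap_sum; last first.
    by move=> j; exact: (linear_fun_comp (lri j) (@pb_proj_linear j)).
  rewrite -[LHS]tmap_id; congr (tmap _ _ x).
  apply: functional_extensionality_dep => a /=.
  by rewrite -(linear_eq_sum _ _ rlin) -(prod_decomp (pb_val a)) rK.
by rewrite (E s) (E t); apply: eq_bigr => j _; rewrite st.
Qed.

Context (H : hopf_algebra K) (rho : forall j, A j -> tensor (A j) H).
Context (crho : forall j, is_comodule_algebra (@rho j)).
Context (cr : forall j,
  colinear (prod_coaction rho) (@rho j) (fun x => pb_proj j (r x))).

(** P is the image of a colinear idempotent of the product, so the coaction of the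
    product restricts to it. *)
Lemma pullback_comodule_algebra :
  exists rhoP : P -> tensor P H,
    [/\ is_comodule_algebra rhoP, is_componentwise rho rhoP
      & forall rhoP', is_componentwise rho rhoP' -> rhoP' =1 rhoP].
Proof.
pose rhoP (a : P) : tensor P H := tmap r id (prod_coaction rho (pb_val a)).
have rhoPE : is_componentwise rho rhoP.
  move=> j a; rewrite /rhoP tmap_comp //.
  by have /= := cr j (pb_val a); rewrite rK.
exists rhoP; split=> // [|rhoP' rhoPE' a].
  apply: (comodule_algebra_jointly_monic
    (p := fun j => pb_proj j : P -> A j)) crho rhoPE => //.
  - exact: pb_val_inj.
  - exact: pb_proj_monic.
by apply: pb_proj_monic => j; rewrite -rhoPE' rhoPE.
Qed.

End PullbackComodule.

(** * Cosets and the cocycle condition *)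

Section CosetTheory.
Implicit Types U V : zmodType.

Definition additive_subgroup U (I : set U) :=
  I 0 /\ forall x y, I x -> I y -> I (x - y).

Lemma additive_subgroup_ker U V (f : {additive U -> V}) :
  additive_subgroup [set x | f x = 0].
Proof.
by split=> [|x y /= fx fy] /=; rewrite ?raddf0 // raddfB fx fy subrr.
Qed.

Lemma additive_subgroup_image U V (f : {additive U -> V}) (I : set U) :
  additive_subgroup I -> additive_subgroup (f @` I).
Proof.
move=> [I0 IB]; split=> [|_ _ [x Ix <-] [y Iy <-]].
  by exists 0; rewrite ?raddf0.
by exists (x - y); [exact: IB | rewrite raddfB].
Qed.

Lemma additive_subgroup_add U (I L : set U) :
  additive_subgroup I -> additive_subgroup L ->
  additive_subgroup (ideal_add I L).
Proof.
move=> [I0 IB] [L0 LB]; split=> [|_ _ [x Ix [y Ly <-]] [x' Ix' [y' Ly' <-]]].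
  by exists 0 => //; exists 0; rewrite ?addr0.
exists (x - x'); first exact: IB.
by exists (y - y'); [exact: LB | rewrite opprD addrACA].
Qed.

Lemma ideal_addC U (I L : set U) : ideal_add I L = ideal_add L I.
Proof.
apply/seteqP; split=> _ [x Ix [y Ly <-]]; exists y => //;
  by exists x => //; exact: addrC.
Qed.

Lemma coset_self U (I : set U) x : additive_subgroup I -> coset I x x.
Proof. by case=> I0 _; exists 0; rewrite ?addr0. Qed.

Lemma coset_eqP U (I : set U) x y :
  additive_subgroup I -> coset I x = coset I y <-> I (x - y).
Proof.
move=> sI; have [I0 IB] := sI; split=> [xy|].
  by have := coset_self x sI; rewrite xy => -[z Iz <-]; rewrite addrC addKr.
suff sub u v : I (u - v) -> coset I u `<=` coset I v.
  move=> Ixy; apply/seteqP; split; apply: sub => //.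
  by rewrite -opprB -sub0r; exact: IB.
move=> Iuv _ [z Iz <-]; exists (u - v + z).
  2: by rewrite addrA addrCA subrr addr0.
by rewrite -[z]opprK; apply: (IB) => //; rewrite -sub0r; exact: (IB).
Qed.

Section CosetMap.
Context (U V : zmodType) (f : {additive U -> V}) (I : set U).
Context (sI : additive_subgroup I).
Let ker : set U := [set x | f x = 0].

(** The chosen representative does not matter: it differs from x by an element of
    ker f + I, which f sends into f (I). *)
Lemma coset_map_coset x :
  coset_map f I (coset (ideal_add ker I) x) = coset (f @` I) (f x).
Proof.
have sL := additive_subgroup_add (additive_subgroup_ker f) sI.
rewrite /coset_map; case: xgetP => [y _ [_ [a fa [b Ib <-]] <-]|].
  apply/coset_eqP; first exact: additive_subgroup_image.
  by exists b => //; rewrite !raddfD fa add0r addrC addKr.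
by move=> /(_ x) /(_ (coset_self x sL)).
Qed.

Lemma coset_map_inj :
  {in cosets (ideal_add ker I) &, injective (coset_map f I)}.
Proof.
have sL := additive_subgroup_add (additive_subgroup_ker f) sI.
move=> _ _ /set_mem[x _ <-] /set_mem[y _ <-]; rewrite !coset_map_coset.
move=> /(coset_eqP _ _ (additive_subgroup_image f sI))[b Ib fb].
apply/coset_eqP => //; exists (x - y - b); last by exists b; rewrite ?subrK.
by rewrite /ker /= raddfB fb raddfB subrr.
Qed.

End CosetMap.
End CosetTheory.

Section Cocycle.
Context {K : fieldType} {J : finType} (F : gluing_family K J).

Lemma upairC (i j : J) : upair i j = upair j i.
Proof. exact: finset.setUC. Qed.

Lemma fkerC (i j : J) : fker F j i = [set a | fpi F (upair i j) j a = 0].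
Proof. by rewrite /fker upairC. Qed.

Lemma additive_subgroup_fker (i j : J) : additive_subgroup (fker F i j).
Proof. exact: additive_subgroup_ker. Qed.

(** phi^ij_k [x_j] = [x_i] expresses that x_i and x_j have the same image modulo
    the ideal pi^i_j (ker pi^i_k) of A_ij. *)
Lemma transition_cosetP (i j k : J) (xi : falg F i) (xj : falg F j) :
  (forall y, exists x, fpi F (upair i j) i x = y) ->
  fpi F (upair i j) i @` fker F i k = fpi F (upair i j) j @` fker F j k ->
  transition F i j k (coset (ideal_add (fker F j i) (fker F j k)) xj) =
    coset (ideal_add (fker F i j) (fker F i k)) xi <->
  (fpi F (upair i j) i @` fker F i k)
    (fpi F (upair i j) i xi - fpi F (upair i j) j xj).
Proof.
move=> surj ker_eq; have sk l := additive_subgroup_fker l k.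
have inj := @coset_map_inj _ _ (fpi F (upair i j) i) _ (sk i).
have mapi x : coset_map (fpi F (upair i j) i) (fker F i k)
    (coset (ideal_add (fker F i j) (fker F i k)) x) =
    coset (fpi F (upair i j) i @` fker F i k) (fpi F (upair i j) i x).
  exact: (@coset_map_coset _ _ (fpi F (upair i j) i) _ (sk i) x).
have mapj : coset_map (fpi F (upair i j) j) (fker F j k)
    (coset (ideal_add (fker F j i) (fker F j k)) xj) =
    coset (fpi F (upair i j) i @` fker F i k) (fpi F (upair i j) j xj).
  by rewrite (fkerC i j) ker_eq;
    exact: (@coset_map_coset _ _ (fpi F (upair i j) j) _ (sk j) xj).
rewrite /transition mapj.
have [x0 <-] := surj (fpi F (upair i j) j xj).
rewrite -mapi pinvKV //; last by apply/mem_set; exists x0.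
rewrite -coset_eqP; last exact: additive_subgroup_image.
rewrite -!mapi; split=> [->//|e].
by apply: inj; [apply/mem_set; exists x0|apply/mem_set; exists xi|].
Qed.

Definition agree (i j : J) (x : prod_alg (falg F)) :=
  fpi F (upair i j) i (x i) = fpi F (upair i j) j (x j).

Lemma agreeC i j x : agree i j x -> agree j i x.
Proof. by rewrite /agree (upairC j i) => ->. Qed.

(** Compatibility at (i, j) and (j, k) says that phi^jk_i [x_k] = [x_j] and
    phi^ij_k [x_j] = [x_i]; the cocycle condition composes these to
    phi^ik_j [x_k] = [x_i]. *)
Lemma agree_middle (i j k : J) (x : prod_alg (falg F)) :
  (forall i j, i != j -> forall y, exists x, fpi F (upair i j) i x = y) ->
  cocycle_condition F -> uniq [:: i; j; k] ->
  agree i j x -> agree j k x ->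
  (fpi F (upair i k) i @` fker F i j)
    (fpi F (upair i k) i (x i) - fpi F (upair i k) k (x k)).
Proof.
move=> surj coc ijk xij xjk; have [_ tr] := coc i j k ijk.
have := ijk; rewrite /= !inE negb_or andbT => /andP[/andP[ij ik] jk].
have uikj : uniq [:: i; k; j] by rewrite /= !inE negb_or ij ik eq_sym jk.
have ujki : uniq [:: j; k; i] by rewrite /= !inE negb_or jk eq_sym ij eq_sym ik.
apply/transition_cosetP; [exact: surj|exact: (coc i k j uikj).1|].
rewrite tr; last by exists (x k).
have ker0 (a b c : J) : (fpi F (upair a b) a @` fker F a c) 0.
  by exists 0; [exact: (additive_subgroup_fker a c).1 | rewrite raddf0].
rewrite (ideal_addC (fker F k i)).
rewrite (_ : transition F j k i _ =
    coset (ideal_add (fker F j k) (fker F j i)) (x j)); last first.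
  apply/transition_cosetP; [exact: surj|exact: (coc j k i ujki).1|].
  by rewrite xjk subrr; exact: ker0.
rewrite (ideal_addC (fker F j k)) (ideal_addC (fker F i k)).
apply/transition_cosetP; [exact: surj|exact: (coc i j k ijk).1|].
by rewrite xij subrr; exact: ker0.
Qed.

End Cocycle.

(** * Correcting a tuple until it lies in the pullback *)

Section Sweep.
Context {K : fieldType} {J : finType} (F : gluing_family K J).
Context (al : splittings F).
Local Notation A := (falg F).
Implicit Types (i j k l : J) (x y : prod_alg A).

Definition step j l y : prod_alg A :=
  y - in_prod (al (upair j l) j
        (fpi F (upair j l) j (y j) - fpi F (upair j l) l (y l))).

Lemma step_in j l y : step j l y j = y j - al (upair j l) j
  (fpi F (upair j l) j (y j) - fpi F (upair j l) l (y l)).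
Proof. by rewrite /step prod_evalB in_prod_in. Qed.

Lemma step_out j l k y : k != j -> step j l y k = y k.
Proof. by move=> kj; rewrite /step prod_evalB in_prod_out ?subr0 // eq_sym. Qed.

Lemma step_fix j l y : agree j l y -> step j l y = y.
Proof.
move=> yjl; apply: functional_extensionality_dep => k.
have [->|kj] := eqVneq k j.
  by rewrite step_in yjl subrr raddf0 subr0.
exact: step_out.
Qed.

Context (kap : nat -> J).

Fixpoint settle j (k : nat) y : prod_alg A :=
  if k is k'.+1 then step j (kap k') (settle j k' y) else y.

Fixpoint sweep (m : nat) y : prod_alg A :=
  if m is m'.+1 then settle (kap m'.+1) m'.+1 (sweep m' y) else y.

Lemma settleS j (m : nat) y : settle j m.+1 y = step j (kap m) (settle j m y).
Proof. by []. Qed.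

Lemma sweepS (m : nat) y : sweep m.+1 y = settle (kap m.+1) m.+1 (sweep m y).
Proof. by []. Qed.

Lemma settle_out j (k : nat) y l : l != j -> settle j k y l = y l.
Proof. by move=> lj; elim: k => //= k <-; exact: step_out. Qed.

Lemma sweep_out (m : nat) y l :
  (forall m', (0 < m' <= m)%N -> l != kap m') -> sweep m y l = y l.
Proof.
elim: m => // m IHm lm; rewrite sweepS settle_out.
  2: by apply: lm; rewrite leqnn.
by apply: IHm => m' /andP[m'0 m'm]; apply: lm; rewrite m'0 leqW.
Qed.

Context (surj : forall i j, i != j ->
  forall z, exists a : A i, fpi F (upair i j) i a = z).
Context (coc : cocycle_condition F) (alK : is_splitting al).
Context (al_ker : forall i j k, uniq [:: i; j; k] ->
  al (upair i j) i @` (fpi F (upair i j) i @` fker F i k) `<=` fker F i k).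

Lemma step_agree j l y : j != l -> agree j l (step j l y).
Proof.
move=> jl; rewrite /agree step_in step_out 1?eq_sym //.
rewrite (linearB (fpi F _ _)) alK //.
by rewrite opprB addrC subrK.
Qed.

(** The correction term lies in alpha^j_l (pi^j_l (ker pi^j_k)), hence in the
    kernel of pi^j_k. *)
Lemma step_keep j l k y : uniq [:: j; l; k] ->
  agree j k y -> agree k l y -> agree j k (step j l y).
Proof.
move=> jlk yjk ykl.
have := jlk; rewrite /= !inE negb_or andbT => /andP[/andP[jl jk] lk].
have jkl : uniq [:: j; k; l] by rewrite /= !inE negb_or jl jk eq_sym lk.
rewrite /agree step_in step_out 1?eq_sym // (linearB (fpi F _ _)) -yjk.
have -> : fpi F (upair j k) j (al (upair j l) j
    (fpi F (upair j l) j (y j) - fpi F (upair j l) l (y l))) = 0.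
  apply: (al_ker jlk); eexists; last by [].
  exact: (agree_middle surj coc jkl yjk ykl).
by rewrite subr0.
Qed.

Lemma agree_out j l y z : z j = y j -> z l = y l -> agree j l y -> agree j l z.
Proof. by rewrite /agree => -> ->. Qed.

Context (n : nat)
  (kap_inj : forall m l : nat, (m <= n)%N -> (l <= n)%N ->
     kap m = kap l -> m = l).

Lemma kap_neq (m l : nat) :
  (m <= n)%N -> (l <= n)%N -> m != l -> kap m != kap l.
Proof. by move=> mn ln; apply: contra_neq; exact: kap_inj. Qed.

Definition agree_upto (m : nat) y := forall p q, (p <= m)%N -> (q <= m)%N ->
  p != q -> agree (kap p) (kap q) y.

Lemma settle_agree (m k : nat) y :
  (m < n)%N -> (k <= m.+1)%N -> agree_upto m y ->
  forall l : nat, (l < k)%N -> agree (kap m.+1) (kap l) (settle (kap m.+1) k y).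
Proof.
move=> mn + ym; elim: k => [|k IHk] km l //=; rewrite ltnS => lk.
have kn : (k <= n)%N by rewrite (leq_trans _ mn) // ltnW.
have ln := leq_trans lk kn.
have mk : kap m.+1 != kap k by apply: kap_neq; rewrite // gtn_eqF.
have [->|lnk] := eqVneq l k; first exact: step_agree.
have {lk}lk : (l < k)%N by rewrite ltn_neqAle lnk.
have ml : kap m.+1 != kap l.
  by apply: kap_neq; rewrite // gtn_eqF // (ltn_trans lk).
have kl : kap l != kap k by exact: kap_neq.
apply: step_keep; first by rewrite /= !inE negb_or mk ml eq_sym kl.
  by apply: IHk => //; exact: ltnW.
apply: (agree_out (y := y)); rewrite ?settle_out 1?eq_sym //.
by rewrite ltnS in km; apply: ym => //; exact: leq_trans (ltnW lk) km.
Qed.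

Lemma sweep_agree m y : (m <= n)%N -> agree_upto m (sweep m y).
Proof.
elim: m => [|m IHm] mn p q.
  by rewrite !leqn0 => /eqP-> /eqP->; rewrite eqxx.
have agr := settle_agree mn (leqnn _) (IHm (ltnW mn)).
rewrite leq_eqVlt => /predU1P[->|pm]; rewrite leq_eqVlt => /predU1P[->|qm] pq.
- by rewrite eqxx in pq.
- exact: agr.
- exact/agreeC/agr.
- have out (l : nat) : (l < m.+1)%N -> kap l != kap m.+1.
    by move=> lm; apply: kap_neq; rewrite ?ltn_eqF // (leq_trans _ mn) // ltnW.
  apply: (agree_out (y := sweep m y)); rewrite ?sweepS ?settle_out ?out //.
  exact: (IHm (ltnW mn)).
Qed.

Context (kap_surj : forall j, exists2 m, (m <= n)%N & j = kap m).

Lemma sweep_in_pullback y : sweep n y \in in_pullback F.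
Proof.
apply/asboolP => i j ij.
have [p pn ip] := kap_surj i; have [q qn jq] := kap_surj j.
move: ij; rewrite ip jq => pq; apply: (sweep_agree y (leqnn n)) => //.
by apply: contra_neq pq => ->.
Qed.

Lemma sweep_fix m y : (m <= n)%N -> y \in in_pullback F -> sweep m y = y.
Proof.
move=> + /asboolP yP; elim: m => [|m IHm] // mn; rewrite sweepS IHm 1?ltnW //.
suff st (k : nat) : (k <= m.+1)%N -> settle (kap m.+1) k y = y by exact: st.
elim: k => //= k IHk km; rewrite IHk 1?ltnW //; apply: step_fix; apply: yP.
by apply: kap_neq; rewrite ?gtn_eqF // ltnW // (leq_trans km).
Qed.

End Sweep.

(** * The splitting as a corrected tuple *)

Section SweepMorphism.
Context {K : fieldType} {J : finType} (F : gluing_family K J).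
Context (al be : splittings F) (kap : nat -> J).
Local Notation A := (falg F).

(** The starting values a^0_j of the recursion defining alpha_i (a). *)
Definition seed (i : J) (a : A i) : prod_alg A :=
  dfwith (T := fun j => A j)
    (fun j => be (upair j i) j (fpi F (upair j i) i a)) a.

Lemma seed_in i (a : A i) : seed a i = a.
Proof. exact: dfwith_in. Qed.

Lemma seed_out i j (a : A i) : j != i ->
  seed a j = be (upair j i) j (fpi F (upair j i) i a).
Proof. by move=> ji; apply: dfwith_out; rewrite eq_sym. Qed.

Lemma seed1 i : (forall i j : J, i != j -> be (upair i j) i 1 = 1) ->
  seed (1 : A i) = 1.
Proof.
move=> be1; apply: functional_extensionality_dep => j.
have [->|ji] := eqVneq j i; first by rewrite seed_in.
by rewrite seed_out // (fpi_morph_sym F ji).1 be1.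
Qed.

Lemma seed_linear i : linear (@seed i).
Proof.
apply: linear_prod => j; have [->|ji] := eqVneq j i => c a b.
  by rewrite !seed_in.
rewrite !seed_out //.
by rewrite (linearP (fpi F (upair j i) i)) (linearP (be (upair j i) j)).
Qed.

Lemma step_linear j l : linear (@step _ _ F al j l).
Proof.
have lin (U V : lmodType K) (f : {linear U -> V}) : linear f.
  by move=> *; exact: linearP.
have ldiff := linear_fun_sub
  (linear_fun_comp (lin _ _ (fpi F (upair j l) j)) (@proj_linear _ _ A j))
  (linear_fun_comp (lin _ _ (fpi F (upair j l) l)) (@proj_linear _ _ A l)).
have lcorr := linear_fun_comp (lin _ _ (al (upair j l) j)) ldiff.
apply: linear_fun_sub; first exact: linear_idfun.
exact: (linear_fun_comp (@in_prod_linear _ _ A j) lcorr).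
Qed.

Lemma settle_linear j (k : nat) : linear (@settle _ _ F al kap j k).
Proof.
elim: k => // k IHk; exact: (linear_fun_comp (@step_linear j (kap k)) IHk).
Qed.

Lemma sweep_linear (m : nat) : linear (@sweep _ _ F al kap m).
Proof.
elim: m => // m IHm.
exact: (linear_fun_comp (@settle_linear (kap m.+1) m.+1) IHm).
Qed.

(** [settle] makes one correction more than [corrected], the one against
    kappa_0; it vanishes because y_j is already the image under beta of the
    component at kappa_0. *)
Lemma settle_corrected (x y : prod_alg A) j (k : nat) :
  is_splitting be -> (forall l : nat, (l <= k)%N -> j != kap l) ->
  (forall l : nat, (l <= k)%N -> y (kap l) = x (kap l)) ->
  y j = be (upair j (kap 0)) j (fpi F (upair j (kap 0)) (kap 0) (x (kap 0))) ->
  settle al kap j k.+1 y j = corrected al be kap x j k.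
Proof.
move=> beK + + yj; elim: k => [|k IHk] jk yx.
  by rewrite /= step_in yj beK ?jk // yx // subrr raddf0 subr0.
have kj : kap k.+1 != j by rewrite eq_sym jk.
rewrite settleS step_in (settle_out _ _ _ _ kj).
by rewrite yx // IHk // => l lk; [apply: jk | apply: yx]; exact: leqW.
Qed.

Context (H : hopf_algebra K) (rho : forall j, A j -> tensor (A j) H).
Context (rho2 : forall p : {set J}, falg2 F p -> tensor (falg2 F p) H).
Context (rho_alg : forall j, is_comodule_algebra (@rho j)).
Context (rho2_alg : forall j k,
  j != k -> is_comodule_algebra (@rho2 (upair j k))).
Context (fpi_col : forall j k, j != k ->
  colinear (@rho j) (@rho2 (upair j k)) (fpi F (upair j k) j)).
Context (al_col : forall j k, j != k ->
  colinear (@rho2 (upair j k)) (@rho j) (al (upair j k) j)).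
Context (be_col : forall j k, j != k ->
  colinear (@rho2 (upair j k)) (@rho j) (be (upair j k) j)).

Lemma comodule_hom_fpi j k : j != k ->
  comodule_hom (@rho j) (@rho2 (upair j k)) (fpi F (upair j k) j).
Proof. by move=> jk; split; [move=> *; exact: linearP | exact: fpi_col]. Qed.

Lemma comodule_hom_fpi_sym j k : j != k ->
  comodule_hom (@rho k) (@rho2 (upair j k)) (fpi F (upair j k) k).
Proof. by rewrite upairC eq_sym; exact: comodule_hom_fpi. Qed.

Lemma comodule_hom_seed i : comodule_hom (@rho i) (prod_coaction rho) (@seed i).
Proof.
apply: comodule_hom_prod => j; have [->|ji] := eqVneq j i.
  apply: comodule_hom_ext (comodule_hom_id _) => a.
  by rewrite seed_in.
have hbe : comodule_hom (@rho2 (upair j i)) (@rho j) (be (upair j i) j).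
  by split; [move=> *; exact: linearP | exact: be_col].
apply: comodule_hom_ext (comodule_hom_comp hbe (comodule_hom_fpi_sym ji)) => a.
by rewrite seed_out.
Qed.

Lemma comodule_hom_step j l : j != l ->
  comodule_hom (prod_coaction rho) (prod_coaction rho) (@step _ _ F al j l).
Proof.
move=> jl; have proj := comodule_hom_proj rho.
apply: comodule_hom_prod => k; have [->|kj] := eqVneq k j; last first.
  by apply: comodule_hom_ext (proj k) => y; rewrite step_out.
have hal : comodule_hom (@rho2 (upair j l)) (@rho j) (al (upair j l) j).
  by split; [move=> *; exact: linearP | exact: al_col].
have hdiff := comodule_hom_sub (coact_linear (rho2_alg jl))
  (comodule_hom_comp (comodule_hom_fpi jl) (proj j))
  (comodule_hom_comp (comodule_hom_fpi_sym jl) (proj l)).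
have := comodule_hom_sub (coact_linear (rho_alg j)) (proj j)
  (comodule_hom_comp hal hdiff).
by apply: comodule_hom_ext => y; rewrite step_in.
Qed.

Lemma comodule_hom_sweep (n m : nat) :
  (forall p q : nat, (p <= n)%N -> (q < p)%N -> kap p != kap q) -> (m <= n)%N ->
  comodule_hom (prod_coaction rho) (prod_coaction rho) (@sweep _ _ F al kap m).
Proof.
move=> kap_neq; elim: m => [|m IHm] mn; first exact: comodule_hom_id.
apply: comodule_hom_comp (IHm (ltnW mn)).
suff st (k : nat) : (k <= m.+1)%N -> comodule_hom (prod_coaction rho)
    (prod_coaction rho) (@settle _ _ F al kap (kap m.+1) k) by exact: st.
elim: k => [|k IHk] km; first exact: comodule_hom_id.
by apply: comodule_hom_comp (IHk (ltnW km)); apply/comodule_hom_step/kap_neq.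
Qed.

End SweepMorphism.

(** By induction on m, after the m-th stage the components at kappa_0, ..., kappa_m
    have their final value alpha_i (a), while the later ones still have their
    initial value. *)
Lemma alpha_tuple_sweep (K : fieldType) (J : finType) (F : gluing_family K J)
    (al be : splittings F) (n : nat) (kappa : 'I_n.+1 -> J)
    (i : J) (a : falg F i) :
  is_splitting be -> injective kappa -> kappa ord0 = i ->
  (forall j, exists2 m : nat, (m <= n)%N & j = kappa (inord m)) ->
  alpha_tuple al be kappa a = sweep al (fun m => kappa (inord m)) n (seed be a).
Proof.
move=> beK kinj k0 ksurj; pose kap (m : nat) := kappa (inord m).
have kap0 : kap 0%N = i.
  by rewrite -k0; congr kappa; apply: val_inj; rewrite /= inordK.
have kneq (p q : nat) : (p <= n)%N -> (q <= n)%N -> p != q -> kap p != kap q.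
  by move=> pn qn; apply: contra_neq; exact: kap_inj.
set x := alpha_tuple al be kappa a.
have xi : x i = a by exact: alpha_tuple0.
suff sx (m l : nat) : (m <= n)%N -> (l <= m)%N ->
    sweep al kap m (seed be a) (kap l) = x (kap l).
  apply: functional_extensionality_dep => j; have [l ln ->] := ksurj j.
  exact/esym/sx.
elim: m l => [|m IHm] l mn.
  by rewrite leqn0 => /eqP->; rewrite /= kap0 seed_in.
rewrite sweepS leq_eqVlt => /predU1P[->|lm].
  have ml (q : nat) : (q <= m)%N -> kap m.+1 != kap q.
    by move=> qm; apply: kneq; rewrite ?gtn_eqF // (leq_trans qm) // ltnW.
  rewrite (settle_corrected al (x := x) beK ml) => [|q qm|].
  - exact/esym/alpha_tupleS.
  - exact: IHm (ltnW mn) qm.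
  rewrite sweep_out => [|q /andP[q0 qm]]; last exact: ml.
  by rewrite kap0 xi seed_out // -kap0 ml.
rewrite settle_out ?IHm // 1?ltnW //.
by apply: kneq; rewrite ?ltn_eqF // (leq_trans _ mn) // ltnW.
Qed.

Theorem theorem2 (K : fieldType) (J : finType) (F : gluing_family K J)
    (al be : splittings F)
    (hdist : distributive_family F)
    (hcocycle : cocycle_condition F)
    (hal : is_splitting al)
    (hbe : is_splitting be)
    (hbe1 : forall i j : J, i != j -> be (upair i j) i 1 = 1)
    (halker : forall i j k : J, uniq [:: i; j; k] ->
       al (upair i j) i @` (fpi F (upair i j) i @` fker F i k) `<=` fker F i k)
    (n : nat) (hn : #|J| = n.+1)
    (i : J) (kappa : 'I_n.+1 -> J)
    (hkappa : bijective kappa) (hkappa0 : kappa ord0 = i) :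
  (forall a : falg F i, alpha_tuple al be kappa a \in in_pullback F) /\
  exists alpha : {linear falg F i -> pullback_algebra F},
    [/\ forall a, pb_val (alpha a) = alpha_tuple al be kappa a,
        alpha 1 = 1,
        cancel alpha (pb_proj i)
      & (* the comodule case *)
        forall (H : hopf_algebra K)
          (rho : forall j : J, falg F j -> tensor (falg F j) H)
          (rho2 : forall p : {set J}, falg2 F p -> tensor (falg2 F p) H),
          (forall j : J, is_comodule_algebra (rho j)) ->
          (forall j k : J, j != k -> is_comodule_algebra (rho2 (upair j k))) ->
          (forall j k : J, j != k ->
             colinear (rho j) (rho2 (upair j k)) (fpi F (upair j k) j)) ->
          (forall j k : J, j != k ->
             colinear (rho2 (upair j k)) (rho j) (al (upair j k) j)) ->
          (forall j k : J, j != k ->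
             colinear (rho2 (upair j k)) (rho j) (be (upair j k) j)) ->
          exists rhoP : pullback_algebra F -> tensor (pullback_algebra F) H,
            [/\ is_comodule_algebra rhoP,
                is_componentwise rho rhoP,
                forall rhoP', is_componentwise rho rhoP' -> rhoP' =1 rhoP
              & colinear (rho i) rhoP alpha]].
Proof.
have [kinv kinvK kK] := hkappa; have kinj := can_inj kinvK.
pose kap (m : nat) := kappa (inord m).
have kapi (m l : nat) : (m <= n)%N -> (l <= n)%N -> kap m = kap l -> m = l.
  exact: kap_inj.
have ksurj j : exists2 m : nat, (m <= n)%N & j = kap m.
  by exists (kinv j); [rewrite -ltnS | rewrite /kap inord_val kK].
have aE a := @alpha_tuple_sweep K J F al be n kappa i a hbe kinj hkappa0 ksurj.
have sweepP := sweep_in_pullback hdist.1 hcocycle hal halker kapi ksurj.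
have sweepK := sweep_fix al kapi (leqnn n).
pose r (y : prod_alg (falg F)) : pullback_algebra F := MultiPullback (sweepP y).
have rlin : linear r.
  by move=> c x y; apply: val_inj; exact: sweep_linear.
have rK (p : pullback_algebra F) : r (pb_val p) = p.
  by apply: val_inj; apply: sweepK; exact: (valP p).
have alin := linear_fun_comp rlin (@seed_linear _ _ F be i).
have [alpha alphaE] := linear_pack alin.
have alphaV a : pb_val (alpha a) = alpha_tuple al be kappa a.
  by rewrite aE -alphaE.
split=> [a|]; first by rewrite aE.
exists alpha; split=> // [|a|H rho rho2 crho crho2 cfpi cal cbe].
- rewrite -alphaE seed1 //; exact: rK (1 : pullback_algebra F).
- by rewrite /pb_proj alphaV alpha_tuple0.
have hneq (p q : nat) : (p <= n)%N -> (q < p)%N -> kap p != kap q.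
  move=> pn qp; apply: (kap_neq kapi) => //.
    exact: leq_trans (ltnW qp) pn.
  by rewrite gtn_eqF.
have hom_r j :
  comodule_hom (prod_coaction rho) (rho j) (fun x => pb_proj j (r x)).
  apply: (comodule_hom_comp (comodule_hom_proj rho j)).
  exact: (comodule_hom_sweep crho crho2 cfpi cal hneq (leqnn n)).
have [rhoP [cP rhoPE rhoPU]] :=
  pullback_comodule_algebra rlin rK crho (fun j => (hom_r j).2).
exists rhoP; split=> // a; apply: (pb_proj_monic rlin rK) => j.
have [_ hom_a] := comodule_hom_comp (hom_r j) (comodule_hom_seed cfpi cbe i).
by rewrite -rhoPE -alphaE (tmap_comp (@pb_proj_linear _ _ F j) alin) //.
Qed.
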